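(* Let $(\mathfrak{g},\mathfrak{h},\mathfrak{m})$ be an RLA pair. Then $\mathfrak{i}(\mathfrak{g}):=\mathfrak{m}+[\mathfrak{m},\mathfrak{m}]$ is an ideal of $\mathfrak{g}$ and is equal to the minimal transitive subalgebra of $\mathfrak{g}$ with respect to $\mathfrak{m}$. Moreover, the subclass $\mathrm{m}\mathcal{RLP}$ of all $\mathfrak{m}$-generated RLA pairs is a full subcategory of $\mathcal{RLP}$, and the inclusion functor $\mathbf{J}:\mathrm{m}\mathcal{RLP}\to\mathcal{RLP}$ is left adjoint to the functor $\boldsymbol{\mathfrak{i}}:\mathcal{RLP}\to\mathrm{m}\mathcal{RLP}$ which assigns to $(\mathfrak{g},\mathfrak{h},\mathfrak{m})$ the ideal $\mathfrak{i}(\mathfrak{g})$, regarded as the RLA pair $(\mathfrak{i}(\mathfrak{g}),\mathfrak{h}\cap\mathfrak{i}(\mathfrak{g}),\mathfrak{m})$. The unit of this adjunction is an isomorphism and the counit is the injection $\mathfrak{i}(\mathfrak{g})\to\mathfrak{g}$; hence $\mathrm{m}\mathcal{RLP}$ is a coreflective subcategory of $\mathcal{RLP}$.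
   Context: $K$ is a fixed commutative associative unital ring containing $\mathbb{Q}$ as a unital subring; all modules and algebras are over $K$. A reductive Lie algebra pair (RLA pair) $(\mathfrak{g},\mathfrak{h},\mathfrak{m})$ consists of a Lie algebra $\mathfrak{g}$, a subalgebra $\mathfrak{h}\subset\mathfrak{g}$ and a $K$-submodule $\mathfrak{m}\subset\mathfrak{g}$ with $\mathfrak{g}=\mathfrak{h}\oplus\mathfrak{m}$ and $[\mathfrak{h},\mathfrak{m}]\subset\mathfrak{m}$. A morphism $(\mathfrak{g},\mathfrak{h},\mathfrak{m})\to(\mathfrak{g}',\mathfrak{h}',\mathfrak{m}')$ is a Lie algebra morphism $\phi:\mathfrak{g}\to\mathfrak{g}'$ with $\phi(\mathfrak{h})\subset\mathfrak{h}'$ and $\phi(\mathfrak{m})\subset\mathfrak{m}'$. These form the category $\mathcal{RLP}$. A subalgebra $\mathfrak{g}_1\subset\mathfrak{g}$ is called transitive if $\mathfrak{m}\subset\mathfrak{g}_1$; then $(\mathfrak{g}_1,\mathfrak{h}\cap\mathfrak{g}_1,\mathfrak{m})$ is an RLA pair. $(\mathfrak{g},\mathfrak{h},\mathfrak{m})$ is called $\mathfrak{m}$-generated if $\mathfrak{g}=\mathfrak{m}+[\mathfrak{m},\mathfrak{m}]$, where $[\mathfrak m,\mathfrak m]$ is the $K$-span of brackets of elements of $\mathfrak m$. The functor $\boldsymbol{\mathfrak{i}}$ acts on morphisms $\mathfrak{g}\to\mathfrak{g}'$ by restriction to $\mathfrak{i}(\mathfrak{g})\to\mathfrak{i}(\mathfrak{g}')$.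 A full subcategory is coreflective if its inclusion functor has a right adjoint. *)

(* Defs.v *)
From HB Require Import structures.
From mathcomp Require Import all_boot all_order all_algebra.
From mathcomp Require Import boolp classical_sets.

Set Implicit Arguments.
Unset Strict Implicit.
Unset Printing Implicit Defensive.

Import GRing.Theory.
Local Open Scope ring_scope.
Local Open Scope classical_set_scope.

HB.mixin Record Lmodule_isLieAlgebra (K : comNzRingType) V
    of GRing.Lmodule K V := {
  lie : V -> V -> V;
  lie_linearl : forall z : V, linear (fun x : V => lie x z);
  lie_linearr : forall z : V, linear (fun x : V => lie z x);
  lie_alt : forall x : V, lie x x = 0;
  lie_jacobi : forall x y z : V,
    lie x (lie y z) + lie y (lie z x) + lie z (lie x y) = 0 }.

#[short(type="lieAlgebraType")]
HB.structure Definition LieAlgebra (K : comNzRingType) :=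
  { V of GRing.Lmodule K V & Lmodule_isLieAlgebra K V }.

Section Submodules.
Context {K : comNzRingType}.

Definition is_submodule {V : lmodType K} (S : set V) : Prop :=
  submod_closed [in S].

Definition lin_span {V : lmodType K} (A : set V) : set V :=
  [set x | exists2 s : seq (K * V),
     (forall p, p \in s -> A p.2) & x = \sum_(p <- s) p.1 *: p.2].

Definition sum_set {V : lmodType K} (A B : set V) : set V :=
  [set x + y | x in A & y in B].

Definition internal_direct_sum {V : lmodType K} (A B : set V) : Prop :=
  sum_set A B = [set: V] /\ A `&` B = [set 0].

Definition lie_span {g : lieAlgebraType K} (A B : set g) : set g :=
  lin_span [set lie x y | x in A & y in B].

Definition is_subalgebra {g : lieAlgebraType K} (S : set g) : Prop :=
  is_submodule S /\ forall x y, S x -> S y -> S (lie x y).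

Definition is_ideal {g : lieAlgebraType K} (S : set g) : Prop :=
  is_submodule S /\ forall x y, S y -> S (lie x y).

Lemma is_submoduleP {V : lmodType K} (S : set V) :
  is_submodule S <-> S 0 /\ forall a x y, S x -> S y -> S (a *: x + y).
Proof.
split=> [[S0 SD]|[S0 SD]]; split.
- exact: set_mem.
- by move=> a x y Sx Sy; apply: set_mem; apply: SD; apply: mem_set.
- exact: mem_set.
- by move=> a x y /set_mem Sx /set_mem Sy; apply: mem_set; apply: SD.
Qed.

Lemma lin_span_submodule {V : lmodType K} (A : set V) :
  is_submodule (lin_span A).
Proof.
apply/is_submoduleP; split; first by exists [::] => //; rewrite big_nil.
move=> a _ _ [s sA ->] [t tA ->].
exists ([seq (a * p.1, p.2) | p <- s] ++ t).
  move=> p; rewrite mem_cat => /orP[/mapP[q qs ->]|/tA //]; exact: (sA q).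
rewrite big_cat big_map scaler_sumr; congr (_ + _).
by apply: eq_bigr => p _; rewrite scalerA.
Qed.

Lemma sum_set_submodule {V : lmodType K} (A B : set V) :
  is_submodule A -> is_submodule B -> is_submodule (sum_set A B).
Proof.
move=> /is_submoduleP[A0 AD] /is_submoduleP[B0 BD]; apply/is_submoduleP; split.
  by exists 0 => //; exists 0 => //; rewrite addr0.
move=> a _ _ [x Ax [y By <-]] [x' Ax' [y' By' <-]].
exists (a *: x + x'); first exact: AD.
by exists (a *: y + y'); [exact: BD|rewrite scalerDr addrACA].
Qed.

Lemma lin_span_min {V : lmodType K} (A S : set V) :
  is_submodule S -> A `<=` S -> lin_span A `<=` S.
Proof.
move=> /is_submoduleP[S0 SD] AS _ [s sA ->].
elim: s sA => [|p s IH] sA; first by rewrite big_nil.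
rewrite big_cons; apply: SD; first by apply/AS/sA; rewrite mem_head.
by apply: IH => q qs; apply: sA; rewrite inE qs orbT.
Qed.

Lemma sub_lin_span {V : lmodType K} (A : set V) : A `<=` lin_span A.
Proof.
move=> x Ax; exists [:: (1, x)]; last by rewrite big_seq1 scale1r.
by move=> p; rewrite inE => /eqP ->.
Qed.

Lemma lieDl {g : lieAlgebraType K} (x y z : g) :
  lie (x + y) z = lie x z + lie y z.
Proof. by have := lie_linearl z 1 x y; rewrite !scale1r. Qed.

Lemma lieDr {g : lieAlgebraType K} (x y z : g) :
  lie z (x + y) = lie z x + lie z y.
Proof. by have := lie_linearr z 1 x y; rewrite !scale1r. Qed.

Lemma lie0r {g : lieAlgebraType K} (z : g) : lie z 0 = 0.
Proof. by apply: (@addrI _ (lie z 0)); rewrite -lieDr !addr0. Qed.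

Lemma lieN {g : lieAlgebraType K} (x y : g) : lie y x = - lie x y.
Proof.
apply/eqP; rewrite -addr_eq0; apply/eqP.
have := lie_alt (y + x).
by rewrite lieDl !lieDr !lie_alt add0r addr0.
Qed.

End Submodules.

Record lie_subalgebra (K : comNzRingType) (g : lieAlgebraType K) :=
  LieSubalgebra {
    sa_set :> set g;
    sa_closed : is_subalgebra sa_set }.

Section SubalgebraType.
Context {K : comNzRingType} {g : lieAlgebraType K} (S : lie_subalgebra g).

Definition sa_pred : {pred g} := fun x => x \in sa_set S.

Lemma sa_pred_closed : submod_closed sa_pred.
Proof. exact: (sa_closed S).1. Qed.

HB.instance Definition _ := GRing.isSubmodClosed.Build K g sa_pred sa_pred_closed.

Definition sa_type := {x : g | sa_pred x}.

HB.instance Definition _ := SubChoice.on sa_type.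
HB.instance Definition _ := [SubChoice_isSubLmodule of sa_type by <:].

Definition sa_elt (x : g) (Sx : sa_set S x) : sa_type :=
  exist (fun u : g => is_true (sa_pred u)) x (mem_set Sx).

Lemma sa_valP (x : sa_type) : sa_set S (val x).
Proof. by apply: set_mem; apply: (valP x). Qed.

Definition sa_lie (x y : sa_type) : sa_type :=
  sa_elt ((sa_closed S).2 _ _ (sa_valP x) (sa_valP y)).

Lemma sa_lie_linearl z : linear (fun x => sa_lie x z).
Proof. by move=> a x y; apply: val_inj; apply: lie_linearl. Qed.

Lemma sa_lie_linearr z : linear (fun x => sa_lie z x).
Proof. by move=> a x y; apply: val_inj; apply: lie_linearr. Qed.

Lemma sa_lie_alt x : sa_lie x x = 0.
Proof. by apply: val_inj; apply: lie_alt. Qed.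

Lemma sa_lie_jacobi x y z :
  sa_lie x (sa_lie y z) + sa_lie y (sa_lie z x) + sa_lie z (sa_lie x y) = 0.
Proof. by apply: val_inj; apply: lie_jacobi. Qed.

HB.instance Definition _ := Lmodule_isLieAlgebra.Build K sa_type
  sa_lie_linearl sa_lie_linearr sa_lie_alt sa_lie_jacobi.

End SubalgebraType.

Record rla_pair (K : comNzRingType) := RLAPair {
  rla_g :> lieAlgebraType K;
  rla_h : set rla_g;
  rla_m : set rla_g;
  rla_h_subalgebra : is_subalgebra rla_h;
  rla_m_submodule : is_submodule rla_m;
  rla_direct_sum : internal_direct_sum rla_h rla_m;
  rla_lie_hm : forall x y, rla_h x -> rla_m y -> rla_m (lie x y) }.

Arguments rla_h {K} _ _.
Arguments rla_m {K} _ _.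
Arguments rla_h_subalgebra {K} _.
Arguments rla_m_submodule {K} _.
Arguments rla_direct_sum {K} _.

Record rla_morphism (K : comNzRingType) (X Y : rla_pair K) := RLAMorphism {
  rla_fun :> X -> Y;
  rla_fun_linear : linear rla_fun;
  rla_fun_lie : forall x y, rla_fun (lie x y) = lie (rla_fun x) (rla_fun y);
  rla_fun_h : rla_fun @` rla_h X `<=` rla_h Y;
  rla_fun_m : rla_fun @` rla_m X `<=` rla_m Y }.

Section RLAPairs.
Context {K : comNzRingType}.
Implicit Types X Y Z : rla_pair K.

Definition is_transitive_subalgebra X (S : set X) : Prop :=
  is_subalgebra S /\ rla_m X `<=` S.

(* Minimal for inclusion in the strong sense: the least element. *)
Definition is_minimal_transitive_subalgebra X (S : set X) : Prop :=
  is_transitive_subalgebra S /\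
  forall S1 : set X, is_transitive_subalgebra S1 -> S `<=` S1.

Definition ig X : set X := sum_set (rla_m X) (lie_span (rla_m X) (rla_m X)).
Arguments ig : clear implicits.

Definition m_generated X : Prop := [set: X] = ig X.

Lemma rla_morphism_eq X Y (f1 f2 : rla_morphism X Y) : f1 =1 f2 -> f1 = f2.
Proof.
case: f1 f2 => [f1 ? ? ? ?] [f2 ? ? ? ?] /= /funext E.
by subst f2; congr RLAMorphism; apply: Prop_irrelevance.
Qed.

Definition rla_id X : rla_morphism X X.
Proof.
by exists (fun x : X => x) => // [x [y hy <-]|x [y hy <-]].
Defined.

Definition rla_comp X Y Z (f : rla_morphism Y Z) (e : rla_morphism X Y) :
  rla_morphism X Z.
Proof.
exists (fun x => f (e x)).
- by move=> a x y; rewrite !rla_fun_linear.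
- by move=> x y; rewrite !rla_fun_lie.
- by move=> _ [x hx <-]; apply: rla_fun_h; exists (e x) => //; apply: rla_fun_h; exists x.
- by move=> _ [x hx <-]; apply: rla_fun_m; exists (e x) => //; apply: rla_fun_m; exists x.
Defined.

Section TransitivePair.
Context {X : rla_pair K} (S : lie_subalgebra X) (mS : rla_m X `<=` S).

Definition transitive_h : set (sa_type S) := [set x | rla_h X (val x)].
Definition transitive_m : set (sa_type S) := [set x | rla_m X (val x)].

Lemma transitive_h_subalgebra : is_subalgebra transitive_h.
Proof.
have [/is_submoduleP[h0 hD] hL] := rla_h_subalgebra X.
split; last by move=> x y hx hy; apply: hL.
by apply/is_submoduleP; split=> // a x y hx hy; apply: hD.
Qed.

Lemma transitive_m_submodule : is_submodule transitive_m.
Proof.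
have /is_submoduleP[m0 mD] := rla_m_submodule X.
by apply/is_submoduleP; split=> // a x y hx hy; apply: mD.
Qed.

Lemma transitive_direct_sum : internal_direct_sum transitive_h transitive_m.
Proof.
have [hm hm0] := rla_direct_sum X.
have /is_submoduleP[S0 SD] := (sa_closed S).1.
split; apply/seteqP; split=> //.
- move=> x _.
  have: [set: X] (val x) by [].
  rewrite -hm => -[a ha [b mb abx]].
  have Sb : sa_set S b := mS mb.
  have Sx := sa_valP x.
  have Sa : sa_set S a.
    by rewrite -[a](addrK b) abx addrC -scaleN1r; apply: SD.
  exists (sa_elt Sa) => //.
  by exists (sa_elt Sb) => //; apply: val_inj.
- move=> x [hx mx]; apply: val_inj.
  suff: [set (0 : X)] (val x) by [].
  by rewrite -hm0.
- move=> _ ->; split.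
  + by have /is_submoduleP[] := transitive_h_subalgebra.1.
  + by have /is_submoduleP[] := transitive_m_submodule.
Qed.

Lemma transitive_lie_hm (x y : sa_type S) :
  transitive_h x -> transitive_m y -> transitive_m (lie x y).
Proof. exact: rla_lie_hm. Qed.

(* The pair (S, h `&` S, m), with h `&` S and m seen inside the type of S. *)
Definition transitive_pair : rla_pair K :=
  RLAPair transitive_h_subalgebra transitive_m_submodule
    transitive_direct_sum transitive_lie_hm.

End TransitivePair.

Lemma ig_submodule X : is_submodule (ig X).
Proof.
exact: sum_set_submodule (rla_m_submodule X) (lin_span_submodule _).
Qed.

Lemma m_sub_ig X : rla_m X `<=` ig X.
Proof.
move=> x mx; exists x => //; exists 0; last by rewrite addr0.
by have /is_submoduleP[] := lin_span_submodule
  [set lie x y | x in rla_m X & y in rla_m X].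
Qed.

Lemma ig_lie X (x y : X) : ig X x -> ig X y -> ig X (lie x y).
Proof.
have /is_submoduleP[i0 iD] := ig_submodule X.
have /is_submoduleP[m0 mD] := rla_m_submodule X.
have iA u v : ig X u -> ig X v -> ig X (u + v).
  by move=> iu iv; rewrite -[u]scale1r; apply: iD.
have dec u : exists h m, [/\ rla_h X h, rla_m X m & u = h + m].
  have: [set: X] u by [].
  by rewrite -(rla_direct_sum X).1 => -[h hh [m mm <-]]; exists h, m.
have imm u v : rla_m X u -> rla_m X v -> ig X (lie u v).
  move=> mu mv; exists 0 => //; exists (lie u v); last by rewrite add0r.
  by apply: sub_lin_span; exists u => //; exists v.
have ixm u v : rla_m X v -> ig X (lie u v).
  move=> mv; have [h [m [hh mm ->]]] := dec u; rewrite lieDl.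
  by apply: iA (imm _ _ mm mv); apply/m_sub_ig/rla_lie_hm.
have imx u v : rla_m X u -> ig X (lie u v).
  by move=> mu; rewrite lieN -scaleN1r -[_ *: _]addr0; apply: iD => //; apply: ixm.
have jac (u v w : X) : lie u (lie v w) = - lie v (lie w u) - lie w (lie u v).
  apply/eqP; rewrite -opprD -subr_eq0 opprK addrA; exact/eqP/lie_jacobi.
have itriple u v w : rla_m X v -> rla_m X w -> ig X (lie u (lie v w)).
  move=> mv mw; rewrite jac -!scaleN1r.
  by apply: (iD) => //; [apply: imx|rewrite -[_ *: _]addr0; apply: iD => //; apply: imx].
move=> _ [m mm [z zm <-]]; rewrite lieDr; apply: iA; first exact: ixm.
have : [set z | ig X (lie x z)] z; last by [].
apply: lin_span_min zm.
  apply/is_submoduleP; split; first by rewrite /= lie0r.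
  by move=> a u v iu iv; rewrite /= lie_linearr; apply: iD.
by move=> _ [v mv [w mw <-]]; apply: itriple.
Qed.

Definition ig_subalgebra X : lie_subalgebra X :=
  LieSubalgebra (conj (ig_submodule X) (@ig_lie X)).

Definition ig_pair X : rla_pair K :=
  transitive_pair (S := ig_subalgebra X) (@m_sub_ig X).

Lemma ig_pair_m_generated X : m_generated (ig_pair X).
Proof.
apply/seteqP; split=> // x _.
have [a ma [b bm abx]] := sa_valP x.
pose P := [set b : X | exists2 b' : ig_pair X, val b' = b &
  lie_span (rla_m (ig_pair X)) (rla_m (ig_pair X)) b'].
have [b' b'b b'm] : P b.
  apply: lin_span_min bm.
    have /is_submoduleP[s0 sD] := lin_span_submodule
      [set lie x y | x in rla_m (ig_pair X) & y in rla_m (ig_pair X)].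
    apply/is_submoduleP; split; first by exists 0.
    by move=> c _ _ [u <- um] [v <- vm]; exists (c *: u + v) => //; apply: sD.
  move=> _ [u mu [v mv <-]].
  pose u' : ig_pair X := @sa_elt _ _ (ig_subalgebra X) u (m_sub_ig mu).
  pose v' : ig_pair X := @sa_elt _ _ (ig_subalgebra X) v (m_sub_ig mv).
  exists (lie u' v') => //.
  by apply: sub_lin_span; exists u' => //; exists v'.
exists (@sa_elt _ _ (ig_subalgebra X) a (m_sub_ig ma)) => //.
by exists b' => //; apply: val_inj; rewrite /= -abx -b'b.
Qed.

Lemma ig_morphism_subproof X Y (f : rla_morphism X Y) (x : ig_pair X) :
  ig Y (f (val x)).
Proof.
have fD u v : f (u + v) = f u + f v.
  by have := rla_fun_linear f 1 u v; rewrite !scale1r.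
have f0 : f 0 = 0 by apply: (@addrI _ (f 0)); rewrite -fD !addr0.
have fm u : rla_m X u -> rla_m Y (f u).
  by move=> mu; apply: (@rla_fun_m _ _ _ f); exists u.
have [a ma [b bm <-]] := sa_valP x.
rewrite fD; exists (f a); first exact: fm.
exists (f b) => //.
have : [set b | lie_span (rla_m Y) (rla_m Y) (f b)] b; last by [].
apply: lin_span_min bm.
  have /is_submoduleP[s0 sD] := lin_span_submodule
    [set lie x y | x in rla_m Y & y in rla_m Y].
  apply/is_submoduleP; split; first by rewrite /= f0.
  by move=> c u v uP vP; rewrite /= rla_fun_linear; apply: sD.
move=> _ [u mu [v mv <-]]; apply: sub_lin_span.
by exists (f u); [exact: fm|exists (f v); [exact: fm|rewrite rla_fun_lie]].
Qed.

Definition ig_morphism X Y (f : rla_morphism X Y) :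
  rla_morphism (ig_pair X) (ig_pair Y).
Proof.
exists (fun x => @sa_elt _ _ (ig_subalgebra Y) _ (ig_morphism_subproof f x)).
- by move=> a x y; apply: val_inj; apply: rla_fun_linear.
- by move=> x y; apply: val_inj; apply: rla_fun_lie.
- by move=> _ [x hx <-]; apply: (@rla_fun_h _ _ _ f); exists (val x).
- by move=> _ [x hx <-]; apply: (@rla_fun_m _ _ _ f); exists (val x).
Defined.

Definition ig_incl X : rla_morphism (ig_pair X) X.
Proof.
by exists (fun x : ig_pair X => val x) => // [_ [x hx <-]|_ [x hx <-]].
Defined.

End RLAPairs.

Arguments ig {K} X _.

Record category := Category {
  obj :> Type;
  cat_hom : obj -> obj -> Type;
  cat_id : forall x, cat_hom x x;
  cat_comp : forall x y z, cat_hom y z -> cat_hom x y -> cat_hom x z;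
  cat_comp_idl : forall x y (f : cat_hom x y), cat_comp (cat_id y) f = f;
  cat_comp_idr : forall x y (f : cat_hom x y), cat_comp f (cat_id x) = f;
  cat_comp_assoc : forall x y z t (f : cat_hom z t) (e : cat_hom y z) (d : cat_hom x y),
    cat_comp f (cat_comp e d) = cat_comp (cat_comp f e) d }.
Arguments cat_id {_} _.

Definition is_iso (C : category) (x y : C) (f : cat_hom x y) : Prop :=
  exists e : cat_hom y x, cat_comp e f = cat_id x /\ cat_comp f e = cat_id y.

Record functor (C D : category) := Functor {
  fobj :> C -> D;
  fmap : forall x y, cat_hom x y -> cat_hom (fobj x) (fobj y);
  fmap_id : forall x, fmap (cat_id x) = cat_id (fobj x);
  fmap_comp : forall x y z (f : cat_hom y z) (e : cat_hom x y),
    fmap (cat_comp f e) = cat_comp (fmap f) (fmap e) }.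
Arguments fmap {_ _} _ {_ _} _.

(* L is the left adjoint. *)
Record adjunction (C D : category) (L : functor C D) (R : functor D C) :=
  Adjunction {
    adj_unit : forall x : C, cat_hom x (R (L x));
    adj_counit : forall y : D, cat_hom (L (R y)) y;
    unit_natural : forall (x x' : C) (f : cat_hom x x'),
      cat_comp (fmap R (fmap L f)) (adj_unit x) = cat_comp (adj_unit x') f;
    counit_natural : forall (y y' : D) (f : cat_hom y y'),
      cat_comp f (adj_counit y) = cat_comp (adj_counit y') (fmap L (fmap R f));
    triangle_l : forall x : C,
      cat_comp (adj_counit (L x)) (fmap L (adj_unit x)) = cat_id (L x);
    triangle_r : forall y : D,
      cat_comp (fmap R (adj_counit y)) (adj_unit (R y)) = cat_id (R y) }.

Definition is_full_subcategory (C D : category) (J : functor C D) : Prop :=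
  injective J /\ forall x y : C, bijective (fmap J : cat_hom x y -> cat_hom (J x) (J y)).

Definition is_coreflective (C D : category) (J : functor C D) : Prop :=
  is_full_subcategory J /\ exists R : functor D C, inhabited (adjunction J R).

Section RLACategories.
Context (K : comNzRingType).

Definition RLP : category.
Proof.
by exists (rla_pair K) (@rla_morphism K) rla_id rla_comp;
  move=> *; apply: rla_morphism_eq.
Defined.

Record m_rla_pair := MRLAPair {
  m_pair :> rla_pair K;
  m_pair_generated : m_generated m_pair }.

Definition mRLP : category.
Proof.
by exists m_rla_pair (fun X Y : m_rla_pair => rla_morphism X Y)
  (fun X => rla_id X) (fun X Y Z => @rla_comp K X Y Z);
  move=> *; apply: rla_morphism_eq.
Defined.

Definition J_functor : functor mRLP RLP.
Proof.
by apply: (@Functor mRLP RLP (fun X : m_rla_pair => m_pair X)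
  (fun (X Y : m_rla_pair) (f : rla_morphism X Y) => f)).
Defined.

Definition ig_m_rla_pair (X : rla_pair K) : m_rla_pair :=
  MRLAPair (ig_pair_m_generated X).

Definition i_functor : functor RLP mRLP.
Proof.
apply: (@Functor RLP mRLP ig_m_rla_pair
  (fun (X Y : rla_pair K) (f : rla_morphism X Y) => ig_morphism f)).
- by move=> X; apply: rla_morphism_eq => x; apply: val_inj.
- by move=> X Y Z f e; apply: rla_morphism_eq => x; apply: val_inj.
Defined.

End RLACategories.

(* Main.v *)
Require Import Defs.
From HB Require Import structures.
From mathcomp Require Import all_boot all_order all_algebra.
From mathcomp Require Import boolp classical_sets.

(** Write i(g) = m + [m, m]. Since g = h + m and [h, m] lies in m, the bracket
    of any element of g with an element of m lies in i(g)
    ([lie_g_m_sub_ig]). The Jacobi identity rewrites [x, [u, v]], with u and v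
    in m, as a combination of [u, [v, x]] and [v, [x, u]]; the inner brackets
    are in i(g) by the first remark, and the outer ones stay there because i(g)
    is a subalgebra containing m. So i(g) is an ideal ([ig_ideal]). A subalgebra
    containing m contains [m, m] as well, hence i(g) is the least one
    ([ig_minimal_transitive]).

    For the adjunction, a morphism from an m-generated pair X to g takes its
    values in i(g), because X = i(X) and morphisms send i(X) into i(g); so it
    factors uniquely through the inclusion i(g) -> g, which is the counit. The
    unit X -> i(X) is the identity map with a restricted codomain
    ([ig_corestrict]), and the inclusion i(X) -> X is its inverse. Every map that occurs is the identity or
    a restriction on underlying elements, so naturality and the triangle
    identities can be checked on elements of g. *)

Set Implicit Arguments.
Unset Strict Implicit.
Unset Printing Implicit Defensive.

Import GRing.Theory.
Local Open Scope ring_scope.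
Local Open Scope classical_set_scope.

Section Submodule.
Context {K : comNzRingType} {V : lmodType K} (S : set V).
Hypothesis subS : is_submodule S.

Lemma submoduleD x y : S x -> S y -> S (x + y).
Proof.
have /is_submoduleP[_ SD] := subS.
by move=> Sx Sy; rewrite -[x]scale1r; apply: SD.
Qed.

Lemma submoduleN x : S x -> S (- x).
Proof.
have /is_submoduleP[S0 SD] := subS.
by move=> Sx; rewrite -scaleN1r -[_ *: _]addr0; apply: SD.
Qed.

End Submodule.

Section Ideal.
Context {K : comNzRingType} (X : rla_pair K).

(** Split x along g = h + m: the h-part maps m into m, the m-part maps it into
    [m, m]. *)
Lemma lie_g_m_sub_ig (x y : X) : rla_m X y -> ig X (lie x y).
Proof.
move=> my; have : [set: X] x by [].
rewrite -(rla_direct_sum X).1 => -[h hh [m mm <-]].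
rewrite lieDl; apply: submoduleD; first exact: ig_submodule.
  exact/m_sub_ig/rla_lie_hm.
exact: ig_lie (m_sub_ig mm) (m_sub_ig my).
Qed.

Lemma lie_m_g_sub_ig (x y : X) : rla_m X x -> ig X (lie x y).
Proof.
move=> mx; rewrite lieN; apply: submoduleN; first exact: ig_submodule.
exact: lie_g_m_sub_ig.
Qed.

(** The condition on y is linear, so only y in m and y = [u, v] with u, v in m
    have to be considered; the Jacobi identity settles the latter. *)
Lemma ig_ideal : is_ideal (ig X).
Proof.
have iX := ig_submodule X; split=> // x _ [m mm [z zmm <-]].
rewrite lieDr; apply: submoduleD => //; first exact: lie_g_m_sub_ig.
suff : [set z | ig X (lie x z)] z by [].
apply: lin_span_min zmm.
  have /is_submoduleP[i0 iD] := iX.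
  apply/is_submoduleP; split; first by rewrite /= lie0r.
  by move=> a u v iu iv; rewrite /= lie_linearr; apply: iD.
move=> _ [u mu [v mv <-]] /=.
have -> : lie x (lie u v) = - (lie u (lie v x) + lie v (lie x u)).
  by apply/eqP; rewrite -addr_eq0 addrA lie_jacobi.
apply/(submoduleN iX)/(submoduleD iX).
  exact: ig_lie (m_sub_ig mu) (lie_m_g_sub_ig _ mv).
exact: ig_lie (m_sub_ig mv) (lie_g_m_sub_ig _ mu).
Qed.

Lemma ig_minimal_transitive : is_minimal_transitive_subalgebra (ig X).
Proof.
split; first by split; [exact: (sa_closed (ig_subalgebra X))|exact: m_sub_ig].
move=> S [[subS lieS] mS] _ [m mm [z zmm <-]].
apply: submoduleD => //; first exact: mS.
apply: lin_span_min zmm => // _ [u mu [v mv <-]].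
by apply: lieS; apply: mS.
Qed.

End Ideal.

Section Adjunction.
Context {K : comNzRingType}.

Lemma m_generated_ig (X : m_rla_pair K) (x : X) : ig X x.
Proof. by rewrite -(m_pair_generated X). Qed.

(** Transparent, since the adjunction identities are checked on its values. *)
Definition ig_corestrict (X : m_rla_pair K) : rla_morphism X (ig_pair X).
Proof.
exists (fun x : X => @sa_elt _ _ (ig_subalgebra X) x (m_generated_ig x)).
- by move=> a x y; apply: val_inj.
- by move=> x y; apply: val_inj.
- by move=> _ [x hx <-].
- by move=> _ [x mx <-].
Defined.

Definition ig_adjunction : adjunction (J_functor K) (i_functor K).
Proof.
apply: (@Adjunction _ _ (J_functor K) (i_functor K) ig_corestrict (@ig_incl K)).
- by move=> X Y f; apply: rla_morphism_eq => x; apply: val_inj.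
- by move=> X Y f; apply: rla_morphism_eq.
- by move=> X; apply: rla_morphism_eq.
- by move=> X; apply: rla_morphism_eq => x; apply: val_inj.
Defined.

Lemma ig_corestrict_iso (X : mRLP K) :
  is_iso (ig_corestrict X : @cat_hom (mRLP K) X (ig_m_rla_pair X)).
Proof.
exists (ig_incl X); split; apply: rla_morphism_eq => x //.
exact: val_inj.
Qed.

(** Being m-generated is a proposition, so an object of the subcategory is
    determined by its underlying pair, and morphisms are unchanged. *)
Lemma J_full_subcategory : is_full_subcategory (J_functor K).
Proof.
split; last by move=> X Y; exists id.
case=> [X gX] [Y gY] /= eXY; case: _ / eXY in gY *.
by congr MRLAPair; apply: Prop_irrelevance.
Qed.

End Adjunction.

Theorem proposition1 (K : comNzRingType) (iota : {rmorphism rat -> K})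
    (iota_inj : injective iota) :
  (forall X : rla_pair K,
     is_ideal (ig X) /\ is_minimal_transitive_subalgebra (ig X)) /\
  is_full_subcategory (J_functor K) /\
  (exists adj : adjunction (J_functor K) (i_functor K),
     (forall X : mRLP K, is_iso (adj_unit adj X)) /\
     (forall X : RLP K, adj_counit adj X = ig_incl X)) /\
  is_coreflective (J_functor K).
Proof.
split; first by move=> X; split; [exact: ig_ideal|exact: ig_minimal_transitive].
split; first exact: J_full_subcategory.
split; first by exists ig_adjunction; split=> // X; exact: ig_corestrict_iso.
split; first exact: J_full_subcategory.
by exists (i_functor K); constructor; exact: ig_adjunction.
Qed.
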